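(* Let $G$ be a finite, simple, connected graph with vertex set $V$ and maximum degree $m$, and let $\sigma:V\to V$ be an involution of $G$. Let $v\in V$ with $v':=\sigma(v)\neq v$, and let $d=d(v,v')$ be the graph distance between $v$ and $v'$. For a real number $Q$, let $H=A_G+D_Q$ where the potential is $Q$ at $v$ and at $v'$ and $0$ at every other vertex. Then for every $Q\ge m$, $$F(Q)>1-\frac{16\sqrt{m+1}}{\sqrt{Q}},$$ and moreover this lower bound is attained by $p(t)$ at some time $t\ge 0$ with $t=O\big(Q^{d-1}\big)$ as $Q\to\infty$.
   Context: $A_G$ is the adjacency matrix of $G$ and $D_Q$ is the diagonal matrix whose diagonal entries are the potential values at the vertices. An involution of $G$ is a bijection $\sigma:V\to V$ with $\sigma\circ\sigma=\mathrm{id}$ such that $x\sim y$ implies $\sigma(x)\sim\sigma(y)$ (and which preserves the potential; here the potential is $Q$ on $\{v,v'\}$ and $0$ elsewhere, so this holds automatically). The transfer probability from $v$ to $v'$ at time $t$ is $p(t)=|\langle e_v, e^{itH} e_{v'}\rangle|^2$, where $e_x$ is the standard basis vector of vertex $x$, and the fidelity is $F(Q)=\sup_{t\ge 0}p(t)$. *)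

(* Defs.v *)
From HB Require Import structures.
From mathcomp Require Import all_boot all_order all_algebra.
From mathcomp Require Import all_classical all_reals all_analysis.
Set Implicit Arguments. Unset Strict Implicit. Unset Printing Implicit Defensive.
Import Order.TTheory GRing.Theory Num.Theory numFieldNormedType.Exports.
Local Open Scope ring_scope.

Definition simple_graph n (e : rel 'I_n) :=
  (forall x y, e x y = e y x) /\ (forall x, ~~ e x x).

Definition walk n (e : rel 'I_n) (x y : 'I_n) (k : nat) :=
  exists p : seq 'I_n, size p = k /\ path e x p /\ last x p = y.

Definition connected_graph n (e : rel 'I_n) := forall x y, exists k, walk e x y k.

Definition is_dist n (e : rel 'I_n) (x y : 'I_n) (d : nat) :=
  walk e x y d /\ forall k, walk e x y k -> (d <= k)%N.

Definition maxdeg n (e : rel 'I_n) : nat := \max_(x : 'I_n) #|[set y | e x y]|.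

Definition graph_involution n (e : rel 'I_n) (s : 'I_n -> 'I_n) :=
  (forall x, s (s x) = x) /\ (forall x y, e x y -> e (s x) (s y)).

Definition adjmx (R : pzRingType) n (e : rel 'I_n) : 'M[R]_n :=
  \matrix_(i, j) (e i j)%:R.

Definition potmx (R : pzRingType) n (Q : R) (v v' : 'I_n) : 'M[R]_n :=
  \matrix_(i, j) (if (i == j) && ((i == v) || (i == v')) then Q else 0).

Definition hamil (R : pzRingType) n (e : rel 'I_n) (Q : R) (v v' : 'I_n) : 'M[R]_n :=
  adjmx R e + potmx Q v v'.

(* For real symmetric H, <e_v, e^{itH} e_v'> = (cos tH)_{vv'} + i (sin tH)_{vv'};
   these are given by their power series. *)
Definition cos_entry (R : realType) n (H : 'M[R]_n) (t : R) (x y : 'I_n) : R :=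
  limn (series (fun k : nat => (-1) ^+ k * t ^+ (2 * k) / ((2 * k)`!)%:R * (H ^+ (2 * k)) x y)).

Definition sin_entry (R : realType) n (H : 'M[R]_n) (t : R) (x y : 'I_n) : R :=
  limn (series (fun k : nat => (-1) ^+ k * t ^+ (2 * k).+1 / ((2 * k).+1`!)%:R * (H ^+ (2 * k).+1) x y)).

(* transfer probability p(t) = |<e_v, e^{itH} e_v'>|^2 *)
Definition transfer_prob (R : realType) n (H : 'M[R]_n) (v v' : 'I_n) (t : R) : R :=
  cos_entry H t v v' ^+ 2 + sin_entry H t v v' ^+ 2.

Definition fidelity (R : realType) n (H : 'M[R]_n) (v v' : 'I_n) : R :=
  sup [set transfer_prob H v v' t | t in [set t : R | 0 <= t]]%classic.

(* Main.v *)
Require Import Defs.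
From HB Require Import structures.
From mathcomp Require Import all_boot all_order all_algebra.
From mathcomp Require Import all_classical all_reals all_analysis.
From mathcomp Require Import spectral sesquilinear ring lra.
From mathcomp.real_closed Require complex.
Set Implicit Arguments. Unset Strict Implicit. Unset Printing Implicit Defensive.
Import Order.TTheory GRing.Theory Num.Theory numFieldNormedType.Exports.
Local Open Scope ring_scope.

(* If [Q < 256 (m + 1)] the bound is negative, so let [Q] be larger.  The
   involution splits the space into even and odd vectors; testing [H] against
   [e_v + e_v'] and [e_v - e_v'] yields an eigenvector [phi] (even, eigenvalue
   [l1]) and [psi] (odd, eigenvalue [l2]) with value [1] at [v] and
   [l1, l2 > Q - 2].  Away from [v] and [v'] the equation [l phi = A phi] with
   [l >> m] makes them small, so that [phi] and [psi] carry all but a fraction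
   [m / (Q - 2)] of [e_v] and [e_v'].  At time [t = pi / (l1 - l2)] the two
   modes have opposite phases and add up in the amplitude from [v] to [v'],
   while the rest of the spectrum contributes at most its total mass, whence
   [p(t) >= 1 - 4 m / (Q - 2)].  Finally a maximum principle for [phi - psi]
   along a shortest path from [v'] to [v] shows
   [l1 - l2 >= ((l1 + l2) / 2) ^ (1 - d)], so [t = O(Q ^ (d - 1))]. *)

Local Notation dot u w := ((u *m w^T) 0 0).

(** * Real eigenframes of symmetric matrices *)

Section ComplexParts.
Import complex.

Lemma Re_sum (R : rcfType) (I : finType) (F : I -> R[i]) :
  Re (\sum_i F i) = \sum_i Re (F i).
Proof. by apply: (big_morph (@Re R)) => // [[a b] [c d]]. Qed.

Lemma Im_sum (R : rcfType) (I : finType) (F : I -> R[i]) :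
  Im (\sum_i F i) = \sum_i Im (F i).
Proof. by apply: (big_morph (@Im R)) => // [[a b] [c d]]. Qed.

(* A substitute for the real spectral theorem: the real and imaginary parts of a
   complex unitary eigenbasis are real eigenvectors forming a Parseval frame. *)
Lemma eigen_frame (R : rcfType) n (H : 'M[R]_n) : H^T = H ->
  exists (J : finType) (f : J -> 'rV[R]_n) (mu : J -> R),
    (forall j, f j *m H = mu j *: f j) /\ \sum_j (f j)^T *m f j = 1%:M.
Proof.
move=> symH; pose HC := map_mx (real_complex R) H.
have HCherm : HC \is hermsymmx.
  apply: realsym_hermsym.
    by apply/is_hermitianmxP; rewrite expr0 scale1r map_mx_id // map_trmx symH.
  by apply/mxOverP=> i j; rewrite mxE; apply/complex_realP; eexists.
pose P := spectralmx HC; pose D := spectral_diag HC.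
have Punit : P \is unitarymx := spectral_unitarymx HC.
(* Because the eigenvalues are real, the eigenvector equation splits into its real and imaginary
   parts. *)
have Dreal j : D 0 j = real_complex R (Re (D 0 j)).
  by rewrite RRe_real //; apply: (mxOverP (hermitian_spectral_diag_real HCherm)).
have PHC : P *m HC = diag_mx D *m P.
  have /hermitian_normalmx /orthomx_spectralP {1}-> := HCherm.
  by rewrite -/P -/D !mulmxA mulmxV ?mul1mx // unitarymx_unit.
have PP : map_mx Num.conj P^T *m P = 1%:M by exact/mulmx1C/unitarymxP.
pose part (b : bool) := if b then @Re R else @Im R.
exists ('I_n * bool)%type, (fun j => \row_y part j.2 (P j.1 y)),
  (fun j => Re (D 0 j.1)); split => [[j b]|] /=.
  apply/rowP => x; have /matrixP/(_ j x) := PHC.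
  rewrite mul_diag_mx !mxE Dreal => E; under eq_bigr do rewrite mxE.
  transitivity (part b (\sum_y P j y * HC y x)).
    by rewrite /part; case: b; rewrite ?Re_sum ?Im_sum; apply: eq_bigr => y _;
      rewrite !mxE; case: (P j y) => ? ? /=; ring.
  by rewrite E /part; case: b; case: (P j x) => ? ? /=; ring.
apply/matrixP => x y; have /matrixP/(_ x y) := PP.
rewrite !mxE => /(congr1 (@Re R)) E.
transitivity (Re ((x == y)%:R : R[i])); last by case: (x == y).
rewrite -E Re_sum summxE.
rewrite -(pair_bigA _ (fun j b => ((\row_y0 part b (P j y0))^T *m
  \row_y0 part b (P j y0)) x y)) /=.
apply: eq_bigr => j _; rewrite big_bool /= !mxE !big_ord1 !mxE /=.
by case: (P j x) => ? ?; case: (P j y) => ? ? /=; ring.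
Qed.
End ComplexParts.

(** * Dot products and matrix powers *)

Lemma dotE (R : comNzRingType) n (u w : 'rV[R]_n) : dot u w = \sum_x u 0 x * w 0 x.
Proof. by rewrite mxE; apply: eq_bigr => x _; rewrite mxE. Qed.

Lemma dotC (R : comNzRingType) n (u w : 'rV[R]_n) : dot u w = dot w u.
Proof. by rewrite !dotE; apply: eq_bigr => x _; rewrite mulrC. Qed.

Lemma dot_delta (R : comNzRingType) n (u : 'rV[R]_n) x : dot (delta_mx 0 x : 'rV_n) u = u 0 x.
Proof. by rewrite -rowE !mxE. Qed.

Lemma form_delta (R : comNzRingType) n (M : 'M[R]_n) x y :
  ((delta_mx 0 x : 'rV_n) *m M *m (delta_mx 0 y : 'rV_n)^T) 0 0 = M x y.
Proof. by rewrite -rowE trmx_delta -colE !mxE. Qed.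

Lemma eigen_expr (R : comNzRingType) n (H : 'M[R]_n) (f : 'rV[R]_n) l k :
  f *m H = l *: f -> f *m H ^+ k = l ^+ k *: f.
Proof.
move=> fH; elim: k => [|k IHk]; first by rewrite !expr0 scale1r mulmx1.
by rewrite exprSr mulmxA IHk -scalemxAl fH scalerA -exprSr.
Qed.

Lemma trmx_expr (R : comNzRingType) n (H : 'M[R]_n) k : (H ^+ k)^T = H^T ^+ k.
Proof.
elim: k => [|k IHk]; first by rewrite !expr0 trmx1.
by rewrite exprS exprSr trmx_mul IHk.
Qed.

(** * Moments expanded in an eigenframe *)

Section Frame.
Variables (R : realFieldType) (n : nat) (H : 'M[R]_n).
Variables (J : finType) (f : J -> 'rV[R]_n) (mu : J -> R).
Hypotheses (fH : forall j, f j *m H = mu j *: f j).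
Hypothesis (f1 : \sum_j (f j)^T *m f j = 1%:M).

Lemma frame_form (u w : 'rV[R]_n) k : (u *m H ^+ k *m w^T) 0 0 =
  \sum_j dot u (f j) * dot w (f j) * mu j ^+ k.
Proof.
rewrite -{1}[u]mulmx1 -f1 mulmx_sumr !mulmx_suml summxE; apply: eq_bigr => j _.
rewrite mulmxA -(mulmxA _ (f j)) (eigen_expr k (fH j)).
rewrite -scalemxAr -scalemxAl -mulmxA mxE [X in _ * X]mxE big_ord1.
by rewrite (dotC w) mulrC.
Qed.

Lemma frame_dot (u w : 'rV[R]_n) : dot u w = \sum_j dot u (f j) * dot w (f j).
Proof.
have := frame_form u w 0; rewrite expr0 mulmx1 => ->.
by apply: eq_bigr => j _; rewrite mulr1.
Qed.

(** AM-GM on each term, then Parseval in the form [frame_dot]. *)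
Lemma frame_coef_sum (u w : 'rV[R]_n) : \sum_j `|dot u (f j) * dot w (f j)| <=
  (dot u u + dot w w) / 2.
Proof.
rewrite !frame_dot -big_split /= mulr_suml; apply: ler_sum => j _.
set a := dot u _; set b := dot w _; rewrite ler_norml; apply/andP; split.
  by have := sqr_ge0 (a + b); nra.
by have := sqr_ge0 (a - b); nra.
Qed.

Hypothesis symH : H^T = H.

(* The remainders of [u] and [w] after projecting out [phi] and [psi] are
   orthogonal to both modes, so only their frame coefficients survive. *)
Lemma two_mode_moments (phi psi u w : 'rV[R]_n) l1 l2 :
  phi *m H = l1 *: phi -> psi *m H = l2 *: psi -> dot phi psi = 0 ->
  dot phi phi != 0 -> dot psi psi != 0 ->
  dot u phi = 1 -> dot u psi = 1 -> dot w phi = 1 -> dot w psi = -1 ->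
  dot u u = 1 -> dot w w = 1 ->
  exists s : seq (R * R),
    (forall k, (u *m H ^+ k *m w^T) 0 0 =
      (dot phi phi)^-1 * l1 ^+ k - (dot psi psi)^-1 * l2 ^+ k +
      \sum_(p <- s) p.1 * p.2 ^+ k) /\
    \sum_(p <- s) `|p.1| <= 1 - ((dot phi phi)^-1 + (dot psi psi)^-1).
Proof.
move=> phiH psiH phipsi N1 N2 uphi upsi wphi wpsi uu ww.
set a := (dot phi phi)^-1; set b := (dot psi psi)^-1.
have a1 : a * dot phi phi = 1 by rewrite mulVf.
have b1 : b * dot psi psi = 1 by rewrite mulVf.
have bil (M : 'M[R]_n) (x1 x2 x3 y1 y2 y3 : 'rV[R]_n) c1 c2 c3 c4 :
    ((x1 + c1 *: x2 + c2 *: x3) *m M *m (y1 + c3 *: y2 + c4 *: y3)^T) 0 0 =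
    (x1 *m M *m y1^T) 0 0 + c3 * (x1 *m M *m y2^T) 0 0 +
    c4 * (x1 *m M *m y3^T) 0 0 +
    c1 * ((x2 *m M *m y1^T) 0 0 + c3 * (x2 *m M *m y2^T) 0 0 +
          c4 * (x2 *m M *m y3^T) 0 0) +
    c2 * ((x3 *m M *m y1^T) 0 0 + c3 * (x3 *m M *m y2^T) 0 0 +
          c4 * (x3 *m M *m y3^T) 0 0).
  have trD (A B : 'rV[R]_n) : (A + B)^T = A^T + B^T by rewrite linearD.
  have trZ c (A : 'rV[R]_n) : (c *: A)^T = c *: A^T by rewrite linearZ.
  rewrite !trD !trZ !mulmxDl !mulmxDr -!scalemxAr -!scalemxAl.
  have mxD (A B : 'M[R]_1) : (A + B) 0 0 = A 0 0 + B 0 0 by rewrite mxE.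
  have mxZ c (A : 'M[R]_1) : (c *: A) 0 0 = c * A 0 0 by rewrite mxE.
  by rewrite !(mxD, mxZ); ring.
(* Since [a] and [b] are inverse squared norms, this subtracts the orthogonal projections; [w] has
   product [-1] with [psi], hence the [+ b] in [r']. *)
pose r := u + (- a) *: phi + (- b) *: psi.
pose r' := w + (- a) *: phi + b *: psi.
have fl (x z : 'rV[R]_n) l k : x *m H = l *: x ->
    (x *m H ^+ k *m z^T) 0 0 = l ^+ k * dot x z.
  by move=> /(eigen_expr k) ->; rewrite -scalemxAl mxE.
have fr (x z : 'rV[R]_n) l k : x *m H = l *: x ->
    (z *m H ^+ k *m x^T) 0 0 = l ^+ k * dot x z.
  move=> /(eigen_expr k) xH; have := congr1 trmx xH.
  rewrite trmx_mul trmx_expr symH linearZ /= -mulmxA => ->.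
  by rewrite -scalemxAr mxE dotC.
have psiphi : dot psi phi = 0 by rewrite dotC.
exists [seq (dot r (f j) * dot r' (f j), mu j) | j <- enum J]; split.
  move=> k; rewrite big_map big_enum /= -frame_form /r /r' bil.
  rewrite !(fl _ _ _ _ phiH, fl _ _ _ _ psiH, fr _ _ _ _ phiH, fr _ _ _ _ psiH).
  rewrite phipsi psiphi (dotC phi u) (dotC psi u) (dotC phi w) (dotC psi w).
  rewrite uphi upsi wphi wpsi.
  set P := l1 ^+ k; set S := l2 ^+ k; set T := (u *m _ *m _) 0 0.
  rewrite !mulrDr !mulr0 !addr0.
  have -> : - a * (- a * (P * dot phi phi)) = a * P by rewrite -[RHS]mul1r -a1; ring.
  have -> : - b * (b * (S * dot psi psi)) = - (b * S) by rewrite -[RHS]mul1r -b1; ring.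
  ring.
rewrite big_map big_enum /=; apply: (le_trans (frame_coef_sum _ _)).
(* With the identity matrix in the middle, [bil] also computes the squared norms of [r] and [r'];
   both equal [1 - (a + b)]. *)
have form1 (x : 'rV[R]_n) : dot x x = (x *m 1%:M *m x^T) 0 0 by rewrite mulmx1.
rewrite (form1 r) (form1 r') /r /r' !bil !mulmx1 phipsi psiphi (dotC phi u) (dotC psi u) (dotC phi w) (dotC psi w).
rewrite uphi upsi wphi wpsi uu ww !mulrDr !mulr0 !addr0.
have -> : - a * (- a * dot phi phi) = a by rewrite -[RHS]mul1r -a1; ring.
have -> : - b * (- b * dot psi psi) = b by rewrite -[RHS]mul1r -b1; ring.
have -> : b * (b * dot psi psi) = b by rewrite -[RHS]mul1r -b1; ring.
lra.
Qed.

End Frame.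

(** * Matrix cosine and sine entries as finite trigonometric sums *)

Lemma cvg_series_lincomb (R : realType) (g : R -> nat -> R) (G : R -> R)
    (s : seq (R * R)) :
  (forall z, (series (g z) @ \oo --> G z)%classic) ->
  (series (fun k => \sum_(p <- s) p.1 * g p.2 k) @ \oo
     --> (\sum_(p <- s) p.1 * G p.2 : R))%classic.
Proof.
move=> cvg_g; have -> : series (fun k => \sum_(p <- s) p.1 * g p.2 k) =
    (fun N => \sum_(p <- s) p.1 * series (g p.2) N).
  apply/funext => N; rewrite /series /= exchange_big /=.
  by apply: eq_bigr => p _; rewrite mulr_sumr.
elim: s => [|p s IHs].
  under eq_fun do rewrite big_nil.
  by rewrite big_nil; apply: cvg_cst.
under eq_fun do rewrite big_cons.
by rewrite big_cons; apply: cvgD IHs; apply: cvgMr; apply: cvg_g.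
Qed.

Section Moments.
Variables (R : realType) (n : nat) (H : 'M[R]_n) (x y : 'I_n).
Variable s : seq (R * R).
Hypothesis momH : forall k, (H ^+ k) x y = \sum_(p <- s) p.1 * p.2 ^+ k.

Lemma cos_entry_moments t :
  cos_entry H t x y = \sum_(p <- s) p.1 * cos (p.2 * t).
Proof.
apply: cvg_lim => //; rewrite [X in series X](_ : _ =
    fun k => \sum_(p <- s) p.1 * cos_coeff' (p.2 * t) k).
  apply: (@cvg_series_lincomb R (fun z => cos_coeff' (z * t))
            (fun z => cos (z * t)) s) => z.
  exact: cvg_cos_coeff'.
apply/funext => k; rewrite momH mulr_sumr; apply: eq_bigr => p _.
rewrite /cos_coeff' mul2n exprMn; set w := _^-1; set c : R := _ ^+ k.
by rewrite -[(-1) ^ k]/c; ring.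
Qed.

Lemma sin_entry_moments t :
  sin_entry H t x y = \sum_(p <- s) p.1 * sin (p.2 * t).
Proof.
apply: cvg_lim => //; rewrite [X in series X](_ : _ =
    fun k => \sum_(p <- s) p.1 * sin_coeff' (p.2 * t) k).
  apply: (@cvg_series_lincomb R (fun z => sin_coeff' (z * t))
            (fun z => sin (z * t)) s) => z.
  exact: cvg_sin_coeff'.
apply/funext => k; rewrite momH mulr_sumr; apply: eq_bigr => p _.
rewrite /sin_coeff' mul2n exprMn; set w := _^-1; set c : R := _ ^+ k.
by rewrite -[(-1) ^ k]/c; ring.
Qed.

Lemma transfer_prob_le t :
  transfer_prob H x y t <= (\sum_(p <- s) `|p.1|) ^+ 2 *+ 2.
Proof.
rewrite /transfer_prob cos_entry_moments sin_entry_moments mulr2n.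
have bnd (F : R -> R) : (forall z, `|F z| <= 1) ->
    (\sum_(p <- s) p.1 * F (p.2 * t)) ^+ 2 <= (\sum_(p <- s) `|p.1|) ^+ 2.
  move=> F1; rewrite -real_normK ?num_real //; apply: lerXn2r.
  - exact: normr_ge0.
  - by apply: sumr_ge0.
  - apply: (le_trans (ler_norm_sum _ _ _)); apply: ler_sum => p _.
    by rewrite normrM ler_piMr.
by apply: lerD; apply: bnd => z; rewrite ler_norml ?cos_geN1 ?cos_le1 ?sin_geN1 ?sin_le1.
Qed.

End Moments.

(** The amplitude is projected onto the unit vector [(C, S)] of the second mode. The half-turn
    between the modes makes their joint contribution [- (a + b)], and by Cauchy-Schwarz the squared
    projection bounds the probability from below. *)
Lemma two_level_transfer (R : realType) n (H : 'M[R]_n) (x y : 'I_n)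
    (a b l1 l2 t : R) (s : seq (R * R)) :
  (forall k, (H ^+ k) x y =
     a * l1 ^+ k - b * l2 ^+ k + \sum_(p <- s) p.1 * p.2 ^+ k) ->
  \sum_(p <- s) `|p.1| <= 1 - (a + b) -> 1 / 2 <= a + b ->
  (l1 - l2) * t = pi ->
  1 - 4 * (1 - (a + b)) <= transfer_prob H x y t.
Proof.
move=> momH sle ab tpi.
have momH' k : (H ^+ k) x y =
    \sum_(p <- (a, l1) :: (- b, l2) :: s) p.1 * p.2 ^+ k.
  by rewrite momH !big_cons /= mulNr addrA.
rewrite /transfer_prob (cos_entry_moments momH') (sin_entry_moments momH').
rewrite !big_cons /=.
have -> : l1 * t = l2 * t + pi by rewrite -tpi; ring.
rewrite cosDpi sinDpi; set C := cos (l2 * t); set S := sin (l2 * t).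
have CS : C ^+ 2 + S ^+ 2 = 1 by exact: cos2Dsin2.
set rc := \sum_(p <- s) _; set rs := \sum_(p <- s) _.
(* Projecting merges each cosine-sine pair of the remainder into one cosine, so the bound is the
   remaining mass itself. *)
have rho : `|C * rc + S * rs| <= 1 - (a + b).
  rewrite /rc /rs !mulr_sumr -big_split /=; apply: le_trans sle.
  apply: (le_trans (ler_norm_sum _ _ _)); apply: ler_sum => p _.
  rewrite [X in `|X|](_ : _ = p.1 * cos (l2 * t - p.2 * t)); last first.
    by rewrite cosB -/C -/S; ring.
  by rewrite normrM ler_piMr // ler_norml cos_geN1 cos_le1.
clearbody C S rc rs; clear -CS rho ab.
set cE := a * _ + _; set sE := a * _ + _.
have proj : C * cE + S * sE = - (a + b) + (C * rc + S * rs).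
  by rewrite /cE /sE -[in RHS](mulr1 (- _)) -CS; ring.
have cauchy : (C * cE + S * sE) ^+ 2 <= cE ^+ 2 + sE ^+ 2.
  have -> : cE ^+ 2 + sE ^+ 2 = (C * cE + S * sE) ^+ 2 + (C * sE - S * cE) ^+ 2.
    by rewrite -[LHS]mul1r -CS; ring.
  by rewrite lerDl sqr_ge0.
apply: le_trans cauchy; rewrite proj.
(* With [z = 1 - (a + b)], the projection has modulus at least [1 - 2 * z], which is nonnegative by
   [ab], and [(1 - 2 * z) ^+ 2 >= 1 - 4 * z]. *)
move: rho; rewrite ler_norml => /andP[? ?]; nra.
Qed.

(** * Size and mass of eigenvectors away from the two marked vertices *)

Section Graph.
Variables (R : realFieldType) (n : nat) (e : rel 'I_n) (Q : R) (v v' : 'I_n).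
Hypothesis sym_e : forall x y, e x y = e y x.
Local Notation m := ((maxdeg e)%:R : R).
Local Notation H := (hamil e Q v v').

Lemma hamil_sym : H^T = H.
Proof.
apply/matrixP => x y; rewrite !mxE sym_e; congr (_ + _).
by rewrite (eq_sym y); case: eqP => //= ->.
Qed.

Lemma eigenrowP (phi : 'rV[R]_n) l : phi *m H = l *: phi <->
  forall x, \sum_(y | e x y) phi 0 y +
    (if (x == v) || (x == v') then Q * phi 0 x else 0) = l * phi 0 x.
Proof.
have eqx x : (phi *m H) 0 x = \sum_(y | e x y) phi 0 y +
    (if (x == v) || (x == v') then Q * phi 0 x else 0).
  rewrite mxE; under eq_bigr do rewrite !mxE mulrDr.
  rewrite big_split /=; congr (_ + _).
    rewrite [RHS]big_mkcond; apply: eq_bigr => y _.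
    by rewrite sym_e; case: (e x y); rewrite ?mulr1 ?mulr0.
  rewrite (bigD1 x) //= eqxx /= big1 ?addr0.
    by case: ifP => _; rewrite ?mulr0 // mulrC.
  by move=> y /negbTE ->; rewrite /= mulr0.
split=> [E x|E]; first by rewrite -eqx E mxE.
by apply/rowP => x; rewrite eqx E mxE.
Qed.

Lemma nbr_sum_le (F : 'I_n -> R) c x :
  0 <= c -> (forall y, F y <= c) -> \sum_(y | e x y) F y <= m * c.
Proof.
move=> c0 Fc; apply: (@le_trans _ _ (\sum_(y | e x y) c)).
  by apply: ler_sum => y _.
rewrite sumr_const -[leLHS]mulr_natl ler_wpM2r // ler_nat.
apply: leq_trans (leq_bigmax x).
by rewrite cardsE.
Qed.

Section Eigenrow.
Variables (phi : 'rV[R]_n) (l : R).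
Hypothesis phiH : phi *m H = l *: phi.

(** Maximum principle: if the largest modulus occurs at [z] off [v] and [v'], the potential-free
    equation bounds [l] times it by [m] times it, so it is zero. *)
Lemma eigenrow_norm_le : m < l -> `|phi 0 v'| <= `|phi 0 v| ->
  forall x, `|phi 0 x| <= `|phi 0 v|.
Proof.
move=> ml le_v x.
case: (@arg_maxP _ _ _ v predT (fun y => `|phi 0 y|)) => // z _ zmax.
apply: le_trans (zmax x isT) _.
have [->|zv] := eqVneq z v; first by [].
have [->|zv'] := eqVneq z v'; first by [].
have /eigenrowP/(_ z) := phiH; rewrite (negbTE zv) (negbTE zv') /= addr0 => E.
have : `|l * phi 0 z| <= m * `|phi 0 z|.
  rewrite -E; apply: le_trans (ler_norm_sum _ _ _) _.
  by apply: nbr_sum_le => // y; apply: zmax.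
have l0 : 0 < l by apply: le_lt_trans ml.
rewrite normrM (gtr0_norm l0) => lm; apply: le_trans (normr_ge0 (phi 0 v)).
rewrite leNgt; apply/negP => z0; move: lm; rewrite ler_pM2r //.
by rewrite leNgt ml.
Qed.

Hypotheses (vv' : v != v') (phiv : phi 0 v = 1) (phiv' : phi 0 v' ^+ 2 = 1).

Lemma eigenrow_norm_le1 : m < l -> forall x, `|phi 0 x| <= 1.
Proof.
move=> ml x; have := eigenrow_norm_le ml _ x; rewrite phiv normr1; apply.
by move/eqP: phiv'; rewrite sqrf_eq1 => /orP[] /eqP ->; rewrite ?normrN1 ?normr1.
Qed.

Lemma eigenvalue_le : m < l -> l <= Q + m.
Proof.
move=> ml; have /eigenrowP/(_ v) := phiH; rewrite eqxx /= phiv !mulr1 => <-.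
rewrite addrC lerD2l -[leRHS]mulr1; apply: nbr_sum_le => // y.
by apply: le_trans (ler_norm _) (eigenrow_norm_le1 ml y).
Qed.

(** Off [v] and [v'], multiply the eigenvector equation by [phi 0 x] and sum. AM-GM on each edge
    bounds the result by the symmetric edge sum [T], which counts each squared entry once per
    incident edge, at most [m] times. *)
Lemma eigenrow_mass : l * (dot phi phi - 2) <= m * dot phi phi.
Proof.
rewrite !dotE; set N := \sum_x _.
have split2 (F : 'I_n -> R) : \sum_x F x = F v + F v' +
    \sum_(x | (x != v) && (x != v')) F x.
  by rewrite (bigD1 v) //= (bigD1 v') 1?eq_sym //= addrA.
have -> : N - 2 = \sum_(x | (x != v) && (x != v')) phi 0 x * phi 0 x.
  by rewrite /N split2 -!expr2 phiv' phiv expr1n; ring.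
pose T := \sum_x \sum_(y | e x y) (phi 0 x ^+ 2 + phi 0 y ^+ 2) / 2.
apply: (@le_trans _ _ T).
  rewrite mulr_sumr /T split2.
  apply: ler_wpDl.
    by apply: addr_ge0; apply: sumr_ge0 => y _; rewrite divr_ge0 // addr_ge0 ?sqr_ge0.
  apply: ler_sum => x /andP[xv xv']; rewrite mulrA.
  have /eigenrowP/(_ x) := phiH; rewrite (negbTE xv) (negbTE xv') /= addr0 => <-.
  rewrite mulr_suml; apply: ler_sum => y _.
  by have := sqr_ge0 (phi 0 x - phi 0 y); nra.
have -> : T = \sum_x \sum_(y | e x y) phi 0 x ^+ 2.
  have half : \sum_x \sum_(y | e x y) phi 0 y ^+ 2 =
      \sum_x \sum_(y | e x y) phi 0 x ^+ 2.
    rewrite (exchange_big_dep predT) //=; apply: eq_bigr => x _.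
    by apply: eq_bigl => y; rewrite sym_e.
  rewrite /T; under eq_bigr do rewrite -mulr_suml big_split /=.
  by rewrite -mulr_suml big_split /= half; field.
rewrite /N mulr_sumr; apply: ler_sum => x _; rewrite -expr2.
by apply: nbr_sum_le => //; rewrite sqr_ge0.
Qed.

End Eigenrow.
End Graph.

(** * Lower bound on the eigenvalue gap *)

Lemma walkS n (e : rel 'I_n) x y k :
  walk e x y k.+1 -> exists2 z, e x z & walk e z y k.
Proof.
case=> -[|z p] [] //= [szp] [/andP[exz pz] lastp].
by exists z => //; exists p.
Qed.

Section Gap.
Variables (R : realFieldType) (n : nat) (e : rel 'I_n) (Q : R) (v v' : 'I_n).
Variable d : nat.
Hypothesis sym_e : forall x y, e x y = e y x.
Hypothesis vv' : v != v'.
Hypothesis dist_d : is_dist e v v' d.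
Local Notation m := ((maxdeg e)%:R : R).
Local Notation H := (hamil e Q v v').
Variables (phi psi : 'rV[R]_n) (l1 l2 : R).
Hypotheses (phiH : phi *m H = l1 *: phi) (psiH : psi *m H = l2 *: psi).
Hypotheses (phiv : phi 0 v = 1) (phiv' : phi 0 v' = 1).
Hypotheses (psiv : psi 0 v = 1) (psiv' : psi 0 v' = -1).
Hypotheses (ml1 : m < l1) (ml2 : m < l2).
Let L := (l1 + l2) / 2.
Hypotheses (m3L : 3 * m <= L) (L1 : 1 <= L).

(* [h] satisfies, off [v] and [v'], the inhomogeneous equation
   [A h = L h + (delta / 2) (phi + psi)] with [h v = 0] and [h v' = 2]; the
   maximum principle makes [h + eta] nonnegative, and then [h + eta] loses at
   most a factor [L] along each edge of a shortest path from [v'] to [v]. *)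
Let delta := l1 - l2.
Let h x := phi 0 x - psi 0 x.
Let eta := `|delta| / (L - m).

Let Lm : 0 < L - m.
Proof. by rewrite /L; move: ml1 ml2; lra. Qed.

Let eta0 : 0 <= eta.
Proof. by rewrite divr_ge0 // ltW. Qed.

Let etaE : eta * (L - m) = `|delta|.
Proof. by rewrite divfK // gt_eqF. Qed.

Let nbr_h x : x != v -> x != v' ->
  \sum_(y | e x y) h y <= L * h x + `|delta|.
Proof.
move=> xv xv'; rewrite sumrB.
have /(eigenrowP _ _ _ sym_e)/(_ x) := phiH.
have /(eigenrowP _ _ _ sym_e)/(_ x) := psiH.
rewrite (negbTE xv) (negbTE xv') /= !addr0 => -> ->.
have -> : l1 * phi 0 x - l2 * psi 0 x =
    L * h x + delta * ((phi 0 x + psi 0 x) / 2).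
  by rewrite /L /h /delta; field.
rewrite lerD2l; apply: le_trans (ler_norm _) _; rewrite normrM ler_piMr //.
have := eigenrow_norm_le1 sym_e phiH phiv _ ml1 x; rewrite phiv' expr1n => /(_ erefl).
have := eigenrow_norm_le1 sym_e psiH psiv _ ml2 x; rewrite psiv' sqrrN expr1n => /(_ erefl).
by rewrite !ler_norml => /andP[? ?] /andP[? ?]; apply/andP; split; lra.
Qed.

Let h_ge x : - eta <= h x.
Proof.
case: (@arg_minP _ _ _ v predT h) => // z _ zmin.
apply: le_trans (zmin x isT).
have [z0|z0] := leP 0 (h z); first by apply: le_trans z0; rewrite oppr_le0.
have zv : z != v.
  by apply: contraTneq z0 => ->; rewrite /h phiv psiv subrr ltxx.
have zv' : z != v'.
  by apply: contraTneq z0 => ->; rewrite /h phiv' psiv' -leNgt; lra.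
have hz := nbr_h zv zv'.
have : \sum_(y | e z y) - h y <= m * - h z.
  by apply: nbr_sum_le => [|y]; rewrite ?oppr_ge0 ?(ltW z0) // lerN2; apply: zmin.
rewrite sumrN => hz'; rewrite -(ler_pM2r Lm) mulNr etaE; lra.
Qed.

Let nbr_h_ge x y : e x y -> h y + eta - m * eta <= \sum_(z | e x z) h z.
Proof.
move=> exy; have degx : \sum_(z | e x z) eta <= m * eta by apply: nbr_sum_le.
have : h y + eta <= \sum_(z | e x z) (h z + eta).
  rewrite (bigD1 y) //= lerDl; apply: sumr_ge0 => z _.
  by have := h_ge z; lra.
by rewrite big_split /=; lra.
Qed.

Let walk_h k x : (k < d)%N -> walk e x v' k -> 2 <= (h x + eta) * L ^+ k.
Proof.
elim: k x => [|k IHk] x ltkd.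
  case=> -[|? ?] [] //= _ [_ ->]; rewrite expr0 mulr1 /h phiv' psiv'.
  by move: eta0; lra.
move=> wx; have [y exy wy] := walkS wx.
(* A walk of length [k.+1 < d] starting at [v] would contradict the distance. *)
have xv : x != v.
  by apply: contraTneq ltkd => xv; rewrite -leqNgt; apply: dist_d.2; rewrite -xv.
have [->|xv'] := eqVneq x v'.
  rewrite /h phiv' psiv'; have : 1 <= L ^+ k.+1 by apply: exprn_ege1.
  by move: eta0; nra.
apply: le_trans (IHk _ (ltnW ltkd) wy) _; rewrite exprS mulrA.
apply: ler_wpM2r; first by rewrite exprn_ge0 // (le_trans _ L1).
(* By [etaE] the error term is [eta * (L - m)], so the [m * eta] terms cancel and
   [h y + eta <= L * (h x + eta)] remains. *)
have := nbr_h xv xv'; have := nbr_h_ge exy; move: etaE; lra.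
Qed.

(** As [h] vanishes at [v], subtracting the two equations there makes the neighbour sum of [h] equal
    to the gap; the first step of a shortest path bounds that sum from below. *)
Lemma gap_ge : 1 <= (l1 - l2) * L ^+ d.-1.
Proof.
case: d dist_d walk_h => [|k] /= [wv _] walk_hk.
  by case: wv vv' => -[|? ?] [] //= _ [_ ->]; rewrite eqxx.
have [y evy wy] := walkS wv; have hy := walk_hk _ _ (ltnSn k) wy.
have deltaE : \sum_(z | e v z) h z = delta.
  rewrite sumrB.
  have /(eigenrowP _ _ _ sym_e)/(_ v) := phiH.
  have /(eigenrowP _ _ _ sym_e)/(_ v) := psiH.
  by rewrite eqxx /= phiv psiv /delta; lra.
have := nbr_h_ge evy; rewrite deltaE -/delta => nb.
have Lk : 0 < L ^+ k by rewrite exprn_gt0 // (lt_le_trans _ L1).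
(* [m3L] gives [2 * m <= L - m]. *)
have meta : m * eta <= `|delta| / 2.
  have : (L - 3 * m) * eta >= 0 by rewrite mulr_ge0 // subr_ge0.
  by move: etaE; lra.
have : 2 <= (delta + `|delta| / 2) * L ^+ k.
  by apply: le_trans hy _; rewrite ler_pM2r //; lra.
(* A nonnegative gap yields [4 / 3 <= delta * L ^+ k]; a negative one would make the right-hand side
   negative. *)
have [d0|d0] := leP 0 delta; first by rewrite ger0_norm //; lra.
by rewrite ltr0_norm // => hd; have : delta * L ^+ k < 0 by [rewrite pmulr_llt0]; lra.
Qed.

End Gap.

(** * Even and odd eigenvectors with large eigenvalue *)

Section Sector.
Variables (R : rcfType) (n : nat) (e : rel 'I_n) (Q : R) (s : 'I_n -> 'I_n).
Variable v : 'I_n.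
Hypotheses (graph_e : simple_graph e) (inv_s : graph_involution e s).
Hypothesis sv : s v != v.
Local Notation H := (hamil e Q v (s v)).

(** The Rayleigh quotient of [e_v + b e_(s v)] is at least [Q - 1], so some frame vector overlapping
    it has eigenvalue above [Q - 2]. Symmetrising that vector with sign [b] and dividing by the
    overlap [c j] gives [phi]. *)
Lemma sector_eigenrow (b : R) : b ^+ 2 = 1 ->
  exists (phi : 'rV[R]_n) (l : R), [/\ phi *m H = l *: phi, phi 0 v = 1,
    forall x, phi 0 (s x) = b * phi 0 x & Q - 2 < l].
Proof.
move=> b2; have [sym_e irr_e] := graph_e; have [ssx es] := inv_s.
have [J [f [mu [fH f1]]]] := eigen_frame (hamil_sym Q v (s v) sym_e).
pose c j := f j 0 v + b * f j 0 (s v).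
have mom k x y : (H ^+ k) x y = \sum_j f j 0 x * f j 0 y * mu j ^+ k.
  rewrite -form_delta (frame_form fH f1); apply: eq_bigr => j _.
  by rewrite !dot_delta.
have cmom k : \sum_j c j ^+ 2 * mu j ^+ k = (H ^+ k) v v +
    2 * b * (H ^+ k) v (s v) + (H ^+ k) (s v) (s v).
  rewrite !mom mulr_sumr -!big_split /=; apply: eq_bigr => j _.
  have -> : c j ^+ 2 = f j 0 v ^+ 2 + 2 * b * f j 0 v * f j 0 (s v) +
      b ^+ 2 * f j 0 (s v) ^+ 2 by rewrite /c; ring.
  by rewrite b2; ring.
have [/existsP[j /andP[muj cj]]|/existsPn noj] :=
    boolP [exists j, (Q - 2 < mu j) && (c j != 0)]; last first.
  (* Otherwise the first moment, at least [2 * Q - 2], would be at most [Q - 2] times the zeroth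
     moment, which is [2]. *)
  have : \sum_j (c j ^+ 2 * mu j ^+ 1 - (Q - 2) * (c j ^+ 2 * mu j ^+ 0)) <= 0.
    apply: sumr_le0 => j _; have := noj j; rewrite negb_and -leNgt negbK.
    case/orP=> [muj|/eqP ->]; last by rewrite expr0n !mul0r mulr0 subrr.
    by rewrite expr0 expr1; have := sqr_ge0 (c j); nra.
  rewrite sumrB -mulr_sumr !cmom expr0 expr1 !mxE !eqxx orbT /=.
  rewrite (negbTE (irr_e _)) (negbTE (irr_e _)) (eq_sym v) (negbTE sv) /=.
  move=> neg; exfalso; move: neg.
  by move/eqP: b2; rewrite sqrf_eq1 => /orP[] /eqP ->;
    case: (e v (s v)) => /=; rewrite ?mulr1n ?mulr0n; lra.
pose phi : 'rV[R]_n := \row_x ((c j)^-1 * (f j 0 x + b * f j 0 (s x))).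
exists phi, (mu j); split => //.
- apply/(eigenrowP _ _ _ sym_e) => x.
  have /(eigenrowP _ _ _ sym_e) Ef := fH j.
  (* [sumx] and [potx] express that [H] commutes with [s], so symmetrising keeps the eigenvalue. *)
  have sumx : \sum_(y | e x y) f j 0 (s y) = \sum_(y | e (s x) y) f j 0 y.
    rewrite [RHS](reindex_inj (can_inj ssx)); apply: eq_bigl => y.
    by apply/idP/idP => [/es //|/es]; rewrite !ssx.
  have potx : ((s x == v) || (s x == s v)) = ((x == v) || (x == s v)).
    by rewrite (inj_eq (can_inj ssx)) -(inj_eq (can_inj ssx) (s x)) ssx orbC.
  have := Ef x; have := Ef (s x); rewrite potx => E2 E1.
  under eq_bigr do rewrite mxE.
  rewrite -mulr_sumr big_split -mulr_sumr /= sumx mxE.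
  move: E1 E2; set S1 := \sum_(y | e x y) _; set S2 := \sum_(y | e _ y) _.
  case: ifP => _ E1 E2.
    transitivity ((c j)^-1 * ((S1 + Q * f j 0 x) + b * (S2 + Q * f j 0 (s x)))).
      by ring.
    by rewrite E1 E2; ring.
  transitivity ((c j)^-1 * ((S1 + 0) + b * (S2 + 0))); first by ring.
  by rewrite E1 E2; ring.
- by rewrite mxE mulVf.
- move=> x; rewrite !mxE ssx mulrCA; congr (_ * _).
  by rewrite mulrDr mulrA -expr2 b2 mul1r addrC.
Qed.

End Sector.

(** Makes the supremum in [fidelity] a genuine one: on an unbounded set [sup] is only a default
    value. *)
Lemma transfer_prob_bounded (R : realType) n (H : 'M[R]_n) (x y : 'I_n) :
  H^T = H -> exists B, forall t, transfer_prob H x y t <= B.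
Proof.
move=> /eigen_frame [J [f [mu [fH f1]]]].
pose s := [seq (f j 0 x * f j 0 y, mu j) | j <- enum J].
exists ((\sum_(p <- s) `|p.1|) ^+ 2 *+ 2) => t; apply: transfer_prob_le => k.
rewrite -form_delta (frame_form fH f1) big_map big_enum /=.
by apply: eq_bigr => j _; rewrite !dot_delta.
Qed.

(** * Choice of the transfer time *)

Section Transfer.
Variables (R : realType) (n : nat) (e : rel 'I_n) (s : 'I_n -> 'I_n).
Variables (v : 'I_n) (d : nat) (Q : R).
Hypotheses (graph_e : simple_graph e) (inv_s : graph_involution e s).
Hypotheses (sv : s v != v) (dist_d : is_dist e v (s v) d).
Local Notation m := ((maxdeg e)%:R : R).
Local Notation H := (hamil e Q v (s v)).

(** With [kappa = m / (Q - 2)], [m <= kappa * l] turns [eigenrow_mass] into [N - 2 <= kappa * N] for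
    the squared norm [N]. *)
Lemma eigenrow_massV (phi : 'rV[R]_n) l : 2 < Q -> Q - 2 < l ->
  phi *m H = l *: phi -> phi 0 v = 1 -> phi 0 (s v) ^+ 2 = 1 ->
  0 < dot phi phi /\ (1 - m / (Q - 2)) / 2 <= (dot phi phi)^-1.
Proof.
move=> Q2 lQ phiH phiv phisv; have [sym_e _] := graph_e.
have N0 : 0 < dot phi phi.
  rewrite dotE (bigD1 v) //= phiv mulr1 ltr_pwDl //.
  by apply: sumr_ge0 => x _; rewrite -expr2 sqr_ge0.
have vsv : v != s v by rewrite eq_sym.
have mass := eigenrow_mass sym_e phiH vsv phiv phisv.
split=> //; rewrite -[leRHS]mul1r ler_pdivlMr //; set kappa := m / _.
have k0 : 0 <= kappa by rewrite divr_ge0 // subr_ge0 ltW.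
have l0 : 0 < l by lra.
have km : m <= kappa * l.
  have -> : m = kappa * (Q - 2) by rewrite divfK // gt_eqF // subr_gt0.
  by rewrite ler_wpM2l // ltW.
have : l * (dot phi phi - 2) <= l * (kappa * dot phi phi).
  by apply: le_trans mass _; nra.
rewrite ler_pM2l //; lra.
Qed.

(** Below the threshold [256 * (m + 1)] the final bound is negative; above it, [Q] dominates [m]
    enough for [gap_ge] and for the two modes to carry total weight at least [1 / 2]. *)
Lemma transfer_time : 256 * (m + 1) <= Q ->
  exists t : R, [/\ 0 <= t, t <= pi * (2 * Q) ^+ d.-1 &
    1 - 4 * (m / (Q - 2)) <= transfer_prob H v (s v) t].
Proof.
move=> Qm; have [sym_e irr_e] := graph_e; have [ssx es] := inv_s.
have m0 : 0 <= m by [].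
have vsv : v != s v by rewrite eq_sym.
have [phi [l1 [phiH phiv phis lQ1]]] :=
  sector_eigenrow Q graph_e inv_s sv (expr1n R 2).
have [psi [l2 [psiH psiv psis lQ2]]] :=
  sector_eigenrow Q graph_e inv_s sv (etrans (sqrrN (1 : R)) (expr1n R 2)).
have phisv : phi 0 (s v) = 1 by rewrite phis phiv mulr1.
have psisv : psi 0 (s v) = -1 by rewrite psis psiv mulr1.
have phisv2 : phi 0 (s v) ^+ 2 = 1 by rewrite phisv expr1n.
have psisv2 : psi 0 (s v) ^+ 2 = 1 by rewrite psisv sqrrN expr1n.
have Q2 : 2 < Q by lra.
have ml1 : m < l1 by lra.
have ml2 : m < l2 by lra.
(* Reindexing by [s] changes the sign, the parities being opposite. *)
have ort : dot phi psi = 0.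
  have : dot phi psi = - dot phi psi.
    rewrite !dotE {1}(reindex_inj (can_inj ssx)) -sumrN.
    by apply: eq_bigr => x _; rewrite phis psis; ring.
  lra.
have [N1 aN] := eigenrow_massV Q2 lQ1 phiH phiv phisv2.
have [N2 bN] := eigenrow_massV Q2 lQ2 psiH psiv psisv2.
have [J [f [mu [fH f1]]]] := eigen_frame (hamil_sym Q v (s v) sym_e).
have [||||||r [mom rle]] := two_mode_moments fH f1 (hamil_sym Q v (s v) sym_e)
  (u := delta_mx 0 v) (w := delta_mx 0 (s v)) phiH psiH ort
  (lt0r_neq0 N1) (lt0r_neq0 N2); rewrite ?dot_delta ?mxE ?eqxx //.
set L := (l1 + l2) / 2.
have gap : 1 <= (l1 - l2) * L ^+ d.-1.
  by apply: (gap_ge sym_e vsv dist_d phiH psiH) => //; rewrite /L; lra.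
have L0 : 0 < L by rewrite /L; lra.
(* Both eigenvalues are at most [Q + m]; this is the origin of the factor [2] in the time bound. *)
have LQ : L <= 2 * Q.
  have := eigenvalue_le sym_e phiH phiv phisv2 ml1.
  have := eigenvalue_le sym_e psiH psiv psisv2 ml2.
  by rewrite /L; lra.
have delta0 : 0 < l1 - l2.
  by rewrite -(pmulr_lgt0 _ (exprn_gt0 d.-1 L0)) (lt_le_trans _ gap).
exists (pi / (l1 - l2)); split.
- by rewrite divr_ge0 ?pi_ge0 // ltW.
- rewrite ler_pdivrMr // -mulrA ler_peMr ?pi_ge0 //.
  apply: le_trans gap _; rewrite mulrC ler_wpM2r ?(ltW delta0) //.
  by apply: lerXn2r => //; rewrite nnegrE; lra.
have kappa : m / (Q - 2) <= 1 / 2 by rewrite ler_pdivrMr; lra.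
have momH k : (H ^+ k) v (s v) = (dot phi phi)^-1 * l1 ^+ k -
    (dot psi psi)^-1 * l2 ^+ k + \sum_(p <- r) p.1 * p.2 ^+ k.
  by rewrite -mom form_delta.
apply: le_trans (two_level_transfer momH rle _ _); try lra.
by rewrite mulrC divfK // gt_eqF.
Qed.

End Transfer.

Theorem theorem2 (R : realType) (n : nat) (e : rel 'I_n) (s : 'I_n -> 'I_n)
  (v : 'I_n) (d : nat) :
  simple_graph e -> connected_graph e -> graph_involution e s ->
  s v != v -> is_dist e v (s v) d ->
  (forall Q : R, (maxdeg e)%:R <= Q ->
     1 - 16 * Num.sqrt ((maxdeg e).+1%:R) / Num.sqrt Q
       < fidelity (hamil e Q v (s v)) v (s v)) /\
  (exists C Q0 : R, 0 < C /\
     forall Q : R, (maxdeg e)%:R <= Q ->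
       exists t : R, 0 <= t /\
         1 - 16 * Num.sqrt ((maxdeg e).+1%:R) / Num.sqrt Q
           < transfer_prob (hamil e Q v (s v)) v (s v) t /\
         (Q0 <= Q -> t <= C * Q ^+ d.-1)).
Proof.
move=> graph_e _ inv_s sv dist_d.
(* A walk between distinct vertices has an edge; hence [m <= Q] forces [Q] to be positive. *)
have m1 : (0 < maxdeg e)%N.
  case: d dist_d => [|k] [wv _].
    by case: wv sv => -[|? ?] [] //= _ [_ <-]; rewrite eqxx.
  have [y evy _] := walkS wv; apply: leq_trans (leq_bigmax v).
  by apply/card_gt0P; exists y; rewrite inE.
have m1R : 1 <= (maxdeg e)%:R :> R by rewrite ler1n.
have good (Q : R) : (maxdeg e)%:R <= Q -> exists t : R, [/\ 0 <= t,
    t <= pi * (2 * Q) ^+ d.-1 &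
    1 - 16 * Num.sqrt ((maxdeg e).+1%:R) / Num.sqrt Q
      < transfer_prob (hamil e Q v (s v)) v (s v) t].
  move=> mQ; have Q0 : 0 < Q by lra.
  set sm := Num.sqrt _; set q := Num.sqrt Q.
  have q0 : 0 < q by rewrite sqrtr_gt0.
  have q2 : q ^+ 2 = Q by rewrite sqr_sqrtr // ltW.
  have sm0 : 0 <= sm by exact: sqrtr_ge0.
  have sm2 : sm ^+ 2 = (maxdeg e)%:R + 1 by rewrite sqr_sqrtr // -natr1.
  have [ltQ|geQ] := ltP Q (256 * ((maxdeg e)%:R + 1)).
    (* Here the claimed bound is negative, so any time will do. *)
    exists 0; split=> //.
      by rewrite mulr_ge0 ?pi_ge0 // exprn_ge0 // mulr_ge0 // ltW.
    apply: (@lt_le_trans _ _ 0); last by rewrite addr_ge0 ?sqr_ge0.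
    rewrite subr_lt0 ltr_pdivlMr // mul1r.
    rewrite -(@ltr_pXn2r _ 2) ?nnegrE ?mulr_ge0 // ?ltW //.
    by rewrite exprMn q2 sm2; lra.
  have [t [t0 tle pt]] := transfer_time graph_e inv_s sv dist_d geQ.
  exists t; split=> //; apply: lt_le_trans pt.
  rewrite ltrD2l ltrN2.
  have q16 : 16 * sm <= q.
    rewrite -(@ler_pXn2r _ 2) ?nnegrE ?mulr_ge0 // ?(ltW q0) //.
    by rewrite exprMn q2 sm2; lra.
  have sm1 : 1 <= sm.
    by rewrite -(@ler_pXn2r _ 2) ?nnegrE // expr1n sm2; lra.
  rewrite mulrA ltr_pdivrMr; last by lra.
  rewrite mulrAC ltr_pdivlMr //.
  (* The goal is now [4 * m * q < 16 * sm * (Q - 2)]: [A] bounds [sm ^+ 2 * q] by a multiple of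
     [sm * Q], and [B] absorbs the loss from [Q - 2]. *)
  have -> : (maxdeg e)%:R = sm ^+ 2 - 1 by rewrite sm2; ring.
  have A : 0 <= sm * q * (q - 16 * sm) by rewrite !mulr_ge0 ?subr_ge0 // ltW.
  have B : 0 <= sm * (Q - 256) by rewrite mulr_ge0 // subr_ge0; lra.
  by move: A B; rewrite -q2; nra.
split=> [Q mQ|].
  have [t [t0 _ pt]] := good Q mQ; apply: lt_le_trans pt _.
  have [B Bub] := transfer_prob_bounded v (s v) (hamil_sym Q v (s v) graph_e.1).
  apply: ub_le_sup; last by exists t.
  by exists B => _ [t' _ <-].
(* The time bound holds for every [Q >= m], so the threshold [Q0] can be [0]. *)
exists (pi * 2 ^+ d.-1), 0; split; first by rewrite mulr_gt0 ?pi_gt0 ?exprn_gt0.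
move=> Q mQ; have [t [t0 tle pt]] := good Q mQ; exists t; split=> //; split=> //.
by rewrite -mulrA -exprMn.
Qed.
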